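(* Let $\Gamma$ be a finite connected graph. Then the conjugation action of the right-angled Artin group $A(\Gamma)$ on its extension graph $\Gamma^e$ is acylindrical.
   Context: Graphs are simplicial (no loops or multi-edges). $A(\Gamma)=\langle V(\Gamma)\mid [a,b]=1 \text{ for each } \{a,b\}\in E(\Gamma)\rangle$. The extension graph $\Gamma^e$ has vertex set $\{v^g : v\in V(\Gamma), g\in A(\Gamma)\}$, where $v^g=g^{-1}vg$, with two distinct vertices adjacent if and only if they commute in $A(\Gamma)$. It is equipped with the graph metric (edges of length one), and $A(\Gamma)$ acts on it from the right by conjugation, $v^h\mapsto v^{hg}$. An isometric action of a group $G$ on a path-metric space $X$ is acylindrical if for every $r>0$ there exist $R,N>0$ such that whenever $p,q\in X$ satisfy $d(p,q)\ge R$, the set $\{g\in G : d(p,g.p)\le r \text{ and } d(q,g.q)\le r\}$ has cardinality at most $N$. *)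

(* Defs.v *)
From HB Require Import structures.
From mathcomp Require Import all_boot all_order all_algebra.
From mathcomp Require Import generic_quotient.
From mathcomp Require Import all_classical all_reals all_analysis.

Set Implicit Arguments.
Unset Strict Implicit.
Unset Printing Implicit Defensive.

Import Order.TTheory GRing.Theory Num.Theory.

Local Open Scope classical_set_scope.
Local Open Scope card_scope.
Local Open Scope quotient_scope.

(* The letter [(x, false)] stands for the generator [x], and [(x, true)] for
   its formal inverse. *)
Definition word (X : Type) := seq (X * bool).

Definition inv_word (X : Type) (w : word X) : word X :=
  rev [seq (a.1, ~~ a.2) | a <- w].

Inductive word_eq (X : Type) (rels : set (word X)) : word X -> word X -> Prop :=
| word_eq_refl w : word_eq rels w w
| word_eq_sym w w' : word_eq rels w w' -> word_eq rels w' w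
| word_eq_trans w w' w'' :
    word_eq rels w w' -> word_eq rels w' w'' -> word_eq rels w w''
| word_eq_cancel w w' x b :
    word_eq rels (w ++ [:: (x, b); (x, ~~ b)] ++ w') (w ++ w')
| word_eq_relator w w' r : rels r -> word_eq rels (w ++ r ++ w') (w ++ w').

Section PresentedGroup.
Variables (X : choiceType) (rels : set (word X)).
Local Notation "w ~ w'" := (word_eq rels w w') (at level 70).

Definition word_eqb : rel (word X) := fun w w' => `[< w ~ w' >].

Fact word_eqb_refl : reflexive word_eqb.
Proof. by move=> w; apply/asboolP; apply: word_eq_refl. Qed.

Fact word_eqb_sym : symmetric word_eqb.
Proof.
by move=> w w'; apply/asboolP/asboolP; apply: word_eq_sym.
Qed.

Fact word_eqb_trans : transitive word_eqb.
Proof.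
move=> w' w w'' /asboolP ww' /asboolP w'w''.
by apply/asboolP; apply: word_eq_trans w'w''.
Qed.

Canonical word_equiv :=
  EquivRel word_eqb word_eqb_refl word_eqb_sym word_eqb_trans.

(* The group < X | rels >. *)
Definition presented := {eq_quot word_equiv}.

HB.instance Definition _ := Choice.on presented.
HB.instance Definition _ := EqQuotient.on presented.

Lemma pi_presented w w' : w ~ w' <-> \pi_presented w = \pi_presented w'.
Proof.
split=> [ww'|/eqmodP/asboolP//].
by apply/eqmodP/asboolP.
Qed.

Lemma word_eq_catl u w w' : w ~ w' -> u ++ w ~ u ++ w'.
Proof.
elim=> [v|v v' _|v v' v'' _ + _|v v' x b|v v' r rr].
- exact: word_eq_refl.
- exact: word_eq_sym.
- exact: word_eq_trans.
- by rewrite !(catA u); apply: word_eq_cancel.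
- by rewrite !(catA u); apply: word_eq_relator.
Qed.

Lemma word_eq_catr u w w' : w ~ w' -> w ++ u ~ w' ++ u.
Proof.
elim=> [v|v v' _|v v' v'' _ + _|v v' x b|v v' r rr].
- exact: word_eq_refl.
- exact: word_eq_sym.
- exact: word_eq_trans.
- by rewrite -!catA; apply: word_eq_cancel.
- by rewrite -!catA; apply: word_eq_relator.
Qed.

Lemma word_eq_cat u u' w w' : u ~ u' -> w ~ w' -> u ++ w ~ u' ++ w'.
Proof.
move=> uu' ww'.
exact: word_eq_trans (word_eq_catr _ uu') (word_eq_catl _ ww').
Qed.

Lemma inv_word_cat (u w : word X) : inv_word (u ++ w) = inv_word w ++ inv_word u.
Proof. by rewrite /inv_word map_cat rev_cat. Qed.

Lemma inv_wordK : involutive (@inv_word X).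
Proof.
move=> w; rewrite /inv_word map_rev revK -map_comp -[RHS]map_id.
by apply: eq_map => -[x b] /=; rewrite negbK.
Qed.

Lemma word_eq_mulVg w : inv_word w ++ w ~ [::].
Proof.
elim: w => [|[x b] w IHw]; first exact: word_eq_refl.
apply: word_eq_trans IHw.
rewrite -cat1s inv_word_cat -catA /inv_word /=.
by have := word_eq_cancel rels (inv_word w) w x (~~ b); rewrite negbK.
Qed.

Lemma word_eq_mulgV w : w ++ inv_word w ~ [::].
Proof. by have := word_eq_mulVg (inv_word w); rewrite inv_wordK. Qed.

Lemma word_eq_inv w w' : w ~ w' -> inv_word w ~ inv_word w'.
Proof.
move=> ww'; apply: (@word_eq_trans _ _ _ (inv_word w ++ (w' ++ inv_word w'))).
  rewrite -[X in X ~ _]cats0; apply: word_eq_catl.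
  exact/word_eq_sym/word_eq_mulgV.
rewrite catA; apply: (@word_eq_trans _ _ _ ([::] ++ inv_word w')).
  apply: word_eq_catr; apply: word_eq_trans (word_eq_mulVg w).
  exact/word_eq_catl/word_eq_sym.
exact: word_eq_refl.
Qed.

Definition pres_one : presented := \pi_presented [::].
Definition pres_mul (g h : presented) : presented := \pi_presented (repr g ++ repr h).
Definition pres_inv (g : presented) : presented := \pi_presented (inv_word (repr g)).

Lemma repr_pi w : repr (\pi_presented w) ~ w.
Proof. by apply/pi_presented; rewrite reprK. Qed.

Lemma pres_mulE u w :
  pres_mul (\pi_presented u) (\pi_presented w) = \pi_presented (u ++ w).
Proof. by apply/pi_presented; apply: word_eq_cat; apply: repr_pi. Qed.

Lemma pres_invE w : pres_inv (\pi_presented w) = \pi_presented (inv_word w).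
Proof. by apply/pi_presented; apply: word_eq_inv; apply: repr_pi. Qed.

Lemma presentedP g : exists w, g = \pi_presented w.
Proof. by exists (repr g); rewrite reprK. Qed.

Fact pres_mulA : associative pres_mul.
Proof.
move=> f g h; have [u ->] := presentedP f; have [v ->] := presentedP g.
by have [w ->] := presentedP h; rewrite !pres_mulE catA.
Qed.

Fact pres_mul1g : left_id pres_one pres_mul.
Proof. by move=> g; have [w ->] := presentedP g; rewrite pres_mulE. Qed.

Fact pres_mulg1 : right_id pres_one pres_mul.
Proof. by move=> g; have [w ->] := presentedP g; rewrite pres_mulE cats0. Qed.

Fact pres_mulVg : left_inverse pres_one pres_inv pres_mul.
Proof.
move=> g; have [w ->] := presentedP g; rewrite pres_invE pres_mulE.
exact/pi_presented/word_eq_mulVg.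
Qed.

Fact pres_mulgV : right_inverse pres_one pres_inv pres_mul.
Proof.
move=> g; have [w ->] := presentedP g; rewrite pres_invE pres_mulE.
exact/pi_presented/word_eq_mulgV.
Qed.

HB.instance Definition _ := isGroup.Build presented
  pres_mulA pres_mul1g pres_mulg1 pres_mulVg pres_mulgV.

Definition pres_gen (x : X) : presented := \pi_presented [:: (x, false)].

End PresentedGroup.

Record sgraph := SGraph {
  vertex :> finType;
  edge : rel vertex;
  edge_sym : symmetric edge;
  edge_irrefl : irreflexive edge
}.
Arguments edge {s}.

Definition connected_graph (Gamma : sgraph) : Prop :=
  forall a b : Gamma, connect edge a b.

Section ExtensionGraph.
Variable Gamma : sgraph.

(* The word of [a, b] = a^-1 b^-1 a b. *)
Definition comm_word (a b : Gamma) : word Gamma :=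
  [:: (a, true); (b, true); (a, false); (b, false)].

Definition raag_relators : set (word Gamma) :=
  [set r | exists a b : Gamma, edge a b /\ r = comm_word a b].

Definition raag := presented raag_relators.

HB.instance Definition _ := Choice.on raag.
HB.instance Definition _ := Group.on raag.

Definition raag_gen (a : Gamma) : raag := pres_gen raag_relators a.

Definition ext_vertices : set raag :=
  [set x | exists (v : Gamma) (g : raag), x = (raag_gen v ^ g)%g].

Definition ext_vertex := set_type ext_vertices.

HB.instance Definition _ := Choice.on ext_vertex.
HB.instance Definition _ := SubType.on ext_vertex.

Definition ext_adj (x y : ext_vertex) : Prop :=
  x <> y /\ commute (val x) (val y).

Fact ext_conj_subproof (x : ext_vertex) (g : raag) :
  (val x ^ g)%g \in ext_vertices.
Proof.
by have /set_mem[v [h ->]] := valP x; apply/mem_set; exists v, (h * g)%g; rewrite conjgM.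
Qed.

Definition ext_conj (x : ext_vertex) (g : raag) : ext_vertex :=
  Sub (val x ^ g)%g (ext_conj_subproof x g).

Lemma ext_conj1 x : ext_conj x 1%g = x.
Proof. by apply: val_inj; rewrite /= conjg1. Qed.

Lemma ext_conjM x g h : ext_conj x (g * h)%g = ext_conj (ext_conj x g) h.
Proof. by apply: val_inj; rewrite /= conjgM. Qed.

Lemma ext_conjK g : cancel (ext_conj^~ g) (ext_conj^~ g^-1%g).
Proof. by move=> x; rewrite -ext_conjM mulgV ext_conj1. Qed.

Lemma ext_conjKV g : cancel (ext_conj^~ g^-1%g) (ext_conj^~ g).
Proof. by move=> x; rewrite -ext_conjM mulVg ext_conj1. Qed.

Lemma ext_conj_adj g x y : ext_adj x y -> ext_adj (ext_conj x g) (ext_conj y g).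
Proof.
move=> [xy cxy]; split; first by move/(can_inj (ext_conjK g)).
by rewrite /commute /= -!conjMg cxy.
Qed.

End ExtensionGraph.

Local Open Scope ring_scope.

Section Realization.
Variables (R : realType) (V : eqType) (adj : V -> V -> Prop).

(* Barycentric coordinates of the point at distance [t] from [u] on the edge
   of length one from [u] to [v]; it is the vertex [u] when [u = v]. *)
Definition edge_point (u v : V) (t : R) : V -> R :=
  fun w => (1 - t) * (w == u)%:R + t * (w == v)%:R.

Definition is_bary (f : V -> R) : Prop :=
  exists u v t, [/\ u = v \/ adj u v, 0 <= t <= 1 & f = edge_point u v t].

Record realization := Realization {
  bary :> V -> R;
  baryP : is_bary bary
}.

(* [edge_string p q l]: there is a string p = p_0, p_1, ..., p_n = q of total
   length [l], in which p_i and p_(i+1) lie on a common closed edge and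
   contribute the length of the segment joining them in that edge. *)
Inductive edge_string : realization -> realization -> R -> Prop :=
| edge_string_nil p : edge_string p p 0
| edge_string_cons p q z u v s t l :
    adj u v -> 0 <= s <= 1 -> 0 <= t <= 1 ->
    bary p = edge_point u v s -> bary q = edge_point u v t ->
    edge_string q z l -> edge_string p z (`|s - t| + l).

(* The path metric with edges of length one; it takes the value +oo on points
   of distinct connected components. *)
Definition path_dist (p q : realization) : \bar R :=
  ereal_inf [set l%:E | l in edge_string p q].

Lemma bary_inj (p q : realization) : bary p = bary q -> p = q.
Proof.
case: p q => [f fP] [f' f'P] /= ff'; move: f'P; rewrite -ff' => f'P.
by congr Realization; apply: Prop_irrelevance.
Qed.

End Realization.

(* Isometric right actions on a space with distance [dist]. *)
Record isometric_action (R : realType) (G : groupType) (X : Type)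
    (dist : X -> X -> \bar R) := IsometricAction {
  iact :> X -> G -> X;
  iact1 : forall p, iact p 1%g = p;
  iactM : forall p g h, iact p (g * h)%g = iact (iact p g) h;
  iact_isom : forall g p q, dist (iact p g) (iact q g) = dist p q
}.

Definition acylindrical (R : realType) (G : groupType) (X : Type)
    (dist : X -> X -> \bar R) (act : isometric_action G dist) : Prop :=
  forall r : R, 0 < r ->
  exists (D : R) (N : nat), [/\ 0 < D, (0 < N)%N &
    forall p q : X, (D%:E <= dist p q)%E ->
      [set g : G | (dist p (act p g) <= r%:E)%E /\ (dist q (act q g) <= r%:E)%E]
        #<= `I_N].

Section ExtensionAction.
Variables (R : realType) (Gamma : sgraph).

Definition ext_space := realization R (@ext_adj Gamma).

Lemma edge_point_conj (g : raag Gamma) (u v : ext_vertex Gamma) (t : R) :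
  (fun w => edge_point u v t (ext_conj w g^-1%g)) =
  edge_point (ext_conj u g) (ext_conj v g) t.
Proof.
apply/funext => w; rewrite /edge_point.
have E x : (ext_conj w g^-1%g == x) = (w == ext_conj x g).
  by rewrite -(can_eq (ext_conjK g)) ext_conjKV.
by rewrite !E.
Qed.

Fact ext_act_subproof (p : ext_space) (g : raag Gamma) :
  is_bary (@ext_adj Gamma) (fun w => p (ext_conj w g^-1%g)).
Proof.
have [u [v [t [uv t01 pE]]]] := baryP p.
exists (ext_conj u g), (ext_conj v g), t; split=> //; last first.
  by rewrite pE edge_point_conj.
by case: uv => [->|uv]; [left | right; apply: ext_conj_adj].
Qed.

(* The extension of the vertex map v^h |-> v^(hg) that is affine on every edge. *)
Definition ext_act (p : ext_space) (g : raag Gamma) : ext_space :=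
  Realization (ext_act_subproof p g).

Fact ext_act1 p : ext_act p 1%g = p.
Proof.
by apply: bary_inj; apply/funext => w /=; rewrite invg1 ext_conj1.
Qed.

Fact ext_actM p g h : ext_act p (g * h)%g = ext_act (ext_act p g) h.
Proof.
by apply: bary_inj; apply/funext => w /=; rewrite invgM ext_conjM.
Qed.

Lemma edge_string_act g p q l :
  edge_string p q l -> edge_string (ext_act p g) (ext_act q g) l.
Proof.
elim=> [{}p|{}p {}q z u v s t {}l uv s01 t01 pE qE _ IH]; first exact: edge_string_nil.
apply: edge_string_cons s01 t01 _ _ IH; first exact: (ext_conj_adj g uv).
- by rewrite /= pE edge_point_conj.
- by rewrite /= qE edge_point_conj.
Qed.

Fact ext_act_isom g p q :
  path_dist (ext_act p g) (ext_act q g) = path_dist p q.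
Proof.
congr ereal_inf; apply/seteqP; split=> _ [l pql <-]; exists l => //; last first.
  exact: edge_string_act.
by have := edge_string_act g^-1%g pql; rewrite -!ext_actM mulgV !ext_act1.
Qed.

Definition conjugation_action :
    isometric_action (raag Gamma) (@path_dist R _ (@ext_adj Gamma)) :=
  IsometricAction ext_act1 ext_actM ext_act_isom.

End ExtensionAction.

(* Main.v *)
Require Import Defs.
From mathcomp Require Import all_boot all_order all_algebra.
From mathcomp Require Import generic_quotient finmap zify ring lra.
From mathcomp Require Import all_classical all_reals all_analysis.
From Stdlib Require Setoid Morphisms.

(** Write G for the right-angled Artin group, and say that an element has star
  length at most n when it is a product of n elements, each of which is a word
  in the star of some vertex.  Distances in the extension graph are comparable
  to star length: if [v^g] and [w^h] commute then [h g^-1] lies in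
  [<St w> <St v>] (lemma [commute_gstar_le2]), so a walk of length n from [v^g] to
  [w^h] bounds the star length of [h g^-1] by [2n+2], and conversely the two
  copies of Gamma conjugated by [h] and by [s h] share the vertex [z] as soon as
  [s] is a word in the star of [z].  Moving the two points to vertices and the
  first of these to a vertex of Gamma, acylindricity becomes the statement
  [acyl_words]: if the star length of k is large compared with n, then a bounded
  number of g are such that both g and [g^k] have star length at most n.

  Words are handled up to commutation of adjacent letters (traces), and a trace
  is known through its projections to pairs of non-adjacent vertices.  An element
  of G is a unique trace of reduced words ([reduced_uniq]).  Cancelling in the
  products g k and k [g^k], which are equal, and comparing the two results by the
  Levi lemma shows that the quadrilateral 1, g, gk, k is thin: k = a s b = c s d
  with g = a c^-1 and with a, b, c, d short ([quadrilateral]).  Cut k = u0 W u1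
  once and for all, with u0, u1 just longer than a, b, c, d can be, and W of star
  length at least 3.  Then each g gives a prefix e = g^-1 u0 of k which is short
  and such that e W is again a prefix of k.

  It remains to count the prefixes e of k for which e W is a prefix of k and e is
  short ([window_card]).  As W is long, its support is connected for the
  non-adjacency relation and lies in no star.  For non-adjacent x and y, the
  projections of two prefixes e to {x, y} are comparable, and if they contain
  the same number of x, a letter that occurs in W, then they contain the same
  number of y: otherwise the projections of W and y^j W, with j > 0, would start
  the same word, although their first x is not at the same place.  Hence the
  number of x in e determines e, for each x in the support of W, and all these
  numbers order the prefixes e in the same way.  A word in a star misses a letter
  y of W, so multiplying a prefix p of k by it does not change how many of the e
  have fewer y than p; for the other letters of W this count differs from
  that for y by at most the number of vertices of Gamma.  So a prefix of star
  length m passes at most m |Gamma| of the e, and the largest e passes all the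
  others. *)

Set Implicit Arguments.
Unset Strict Implicit.
Unset Printing Implicit Defensive.

Import Order.TTheory GRing.Theory Num.Theory.
Local Open Scope quotient_scope.

(** * Traces *)

Section Traces.
Variable Gamma : sgraph.
Implicit Types (x y z : Gamma) (l m : Gamma * bool) (a b c d u v w : word Gamma).

Definition proj x y w : word Gamma := [seq l <- w | (l.1 == x) || (l.1 == y)].

(** Equality in the trace monoid, in which adjacent letters commute: a trace is
  determined by its projections to pairs of non-adjacent (possibly equal)
  vertices.  This form makes the congruence and cancellation rules immediate. *)
Definition trace_eq w w' := forall x y, ~~ edge x y -> proj x y w = proj x y w'.
Local Notation "w =t w'" := (trace_eq w w') (at level 70).

Lemma proj_cat x y u v : proj x y (u ++ v) = proj x y u ++ proj x y v.
Proof. exact: filter_cat. Qed.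

#[global] Instance trace_eq_equiv : RelationClasses.Equivalence trace_eq.
Proof.
split=> [w x y _|w w' ww' x y xy|w w' w'' ww' w'w'' x y xy] //.
  by rewrite ww'.
by rewrite ww' ?w'w''.
Qed.

#[global] Instance trace_eq_cat :
  Morphisms.Proper
    (Morphisms.respectful trace_eq (Morphisms.respectful trace_eq trace_eq))
    (@cat (Gamma * bool)).
Proof. by move=> u u' uu' v v' vv' x y xy; rewrite !proj_cat uu' ?vv'. Qed.

#[global] Instance trace_eq_cons :
  Morphisms.Proper
    (Morphisms.respectful eq (Morphisms.respectful trace_eq trace_eq))
    (@cons (Gamma * bool)).
Proof. by move=> l _ <- v v' vv'; rewrite -(cat1s l v) -(cat1s l v') vv'; reflexivity. Qed.

Lemma trace_eq_sym w w' : w =t w' -> w' =t w.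
Proof. by symmetry. Qed.

Lemma trace_eq_catIl u v w : u ++ v =t u ++ w -> v =t w.
Proof.
move=> uvw x y xy; have := uvw x y xy; rewrite !proj_cat.
by move/eqP; rewrite eqseq_cat // eqxx => /eqP.
Qed.

Lemma trace_eq_catIr u v w : v ++ u =t w ++ u -> v =t w.
Proof.
move=> uvw x y xy; have := uvw x y xy; rewrite !proj_cat => e.
have /(congr1 size) := e; rewrite !size_cat => /eqP; rewrite eqn_add2r => /eqP s.
by move/eqP: e; rewrite eqseq_cat // => /andP[/eqP].
Qed.

Lemma trace_eq_consI l v w : l :: v =t l :: w -> v =t w.
Proof. by rewrite -(cat1s l v) -(cat1s l w) => /trace_eq_catIl. Qed.

(** The disjointness of supports that makes two traces commute letter by letter;
  it is stronger than commutation. *)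
Definition indep u v := all (fun l => all (fun m => edge l.1 m.1) v) u.

Lemma indepP u v :
  reflect (forall l m, l \in u -> m \in v -> edge l.1 m.1) (indep u v).
Proof.
apply: (iffP allP) => [uv l m lu mv|uv l lu]; first exact: (allP (uv l lu)).
by apply/allP => m; apply: uv.
Qed.

Lemma indep_sym u v : indep u v = indep v u.
Proof.
by apply/indepP/indepP => uv l m lu mv; rewrite edge_sym; apply: uv.
Qed.

Lemma trace_eq_mem w w' : w =t w' -> w =i w'.
Proof.
move=> ww' l; have /(congr1 (fun s => l \in s)) := ww' l.1 l.1 (negbT (edge_irrefl _)).
by rewrite /= !mem_filter eqxx.
Qed.

Lemma trace_eq_nil w : w =t [::] -> w = [::].
Proof. by case: w => // l w /trace_eq_mem/(_ l); rewrite mem_head. Qed.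

Lemma trace_eq_swap1 l m : edge l.1 m.1 -> [:: l; m] =t [:: m; l].
Proof.
move=> lm x y xy; rewrite /proj /=.
case: ifP => // lxy; case: ifP => // mxy; exfalso.
move: lm lxy mxy xy => /[swap] /orP[/eqP->|/eqP->] /[swap] /orP[/eqP->|/eqP->];
  by rewrite ?edge_irrefl // => e; rewrite ?e //; rewrite edge_sym e.
Qed.

Lemma trace_eq_swapl l u : all (fun m => edge l.1 m.1) u -> l :: u =t u ++ [:: l].
Proof.
elim: u => [|m u IH] /= => [_|/andP[lm /IH lu]]; first by reflexivity.
rewrite -[m :: u ++ _]cat1s -lu.
by rewrite -[l :: m :: u]/([:: l; m] ++ u) trace_eq_swap1.
Qed.

Definition linv l : Gamma * bool := (l.1, ~~ l.2).

Lemma linvK : involutive linv.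
Proof. by case=> x b; rewrite /linv /= negbK. Qed.

(** Left divisibility by a letter: [l] can be moved to the front of [w]. *)
Fixpoint ldiv l w : bool :=
  if w is m :: w' then (m == l) || edge l.1 m.1 && ldiv l w' else false.

Lemma ldiv_trace_eq l w : ldiv l w -> w =t l :: rem l w.
Proof.
elim: w => //= m w IH; case: eqP => [-> _|_ /= /andP[lm /IH lw]]; first by reflexivity.
rewrite {1}lw -[m :: l :: _]/([:: m; l] ++ _) trace_eq_swap1 1?edge_sym //.
Qed.

(** The first letter that does not commute with [l] is seen by one of the
  projections, and these all start with [l]. *)
Lemma trace_eq_ldiv l w w' : w =t l :: w' -> ldiv l w.
Proof.
move=> ww'.
have: forall y, ~~ edge l.1 y -> ohead (proj l.1 y w) = Some l.
  by move=> y ly; rewrite (ww' _ _ ly) /proj /= eqxx.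
elim: w {ww'} => [/(_ l.1)|m w IH hd] /=; first by rewrite edge_irrefl => /(_ isT).
case: eqP => //= /eqP ml.
have lm : edge l.1 m.1.
  case: (boolP (edge _ _)) => // /hd; rewrite /proj /= eqxx orbT /= => -[E].
  by rewrite E eqxx in ml.
rewrite lm; apply: IH => y ly; rewrite -(hd _ ly) /proj /=.
case: eqP => [E|_]; first by rewrite E edge_irrefl in lm.
by case: eqP => [E|//]; rewrite -E lm in ly.
Qed.

Lemma ldiv_proper l w w' : w =t w' -> ldiv l w = ldiv l w'.
Proof.
move=> ww'; apply/idP/idP => /ldiv_trace_eq lw; apply: trace_eq_ldiv.
  by rewrite -ww'; exact: lw.
by rewrite ww'; exact: lw.
Qed.

Lemma ldiv_cat l u v :
  ldiv l (u ++ v) = ldiv l u || all (fun m => edge l.1 m.1) u && ldiv l v.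
Proof.
elim: u => //= m u ->; case: eqP => //= _; case: (edge l.1 m.1) => //=.
Qed.

(** The Levi lemma for traces: two factorizations of a trace have a common
  refinement, and the two pieces that end up in a different order commute. *)
Lemma levi a b c d : a ++ b =t c ++ d -> exists p q r s,
  [/\ a =t p ++ q, b =t r ++ s, c =t p ++ r, d =t q ++ s & indep q r].
Proof.
elim: a c d => [|l a IH] c d /= ab.
  by exists [::], [::], c, d; split=> //; reflexivity.
have: ldiv l (c ++ d) by apply: trace_eq_ldiv; symmetry; exact: ab.
rewrite ldiv_cat => /orP[/ldiv_trace_eq lc|/andP[cl /ldiv_trace_eq ld]].
  have [|p [q [r [s [ap br cp dq qr]]]]] := IH (rem l c) d.
    by apply: (@trace_eq_consI l); rewrite ab {1}lc; reflexivity.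
  exists (l :: p), q, r, s; split=> //; first by rewrite ap; reflexivity.
  by rewrite lc cp; reflexivity.
have [|p [q [r [s [ap br cp dq qr]]]]] := IH c (rem l d).
  apply: (@trace_eq_consI l); rewrite ab {1}ld -cat_cons (trace_eq_swapl cl) -catA.
  reflexivity.
have := cl; rewrite (eq_all_r (trace_eq_mem cp)) all_cat => /andP[lp lr].
exists p, (l :: q), r, s; split=> //.
- by rewrite ap -cat_cons (trace_eq_swapl lp) -catA; reflexivity.
- by rewrite ld dq; reflexivity.
- by rewrite /= lr.
Qed.

End Traces.

Local Notation "w =t w'" := (trace_eq w w') (at level 70).

(** * Reduced words and the word problem *)

Section Reduced.
Variable Gamma : sgraph.
Implicit Types (x y z : Gamma) (l m : Gamma * bool) (a b c d u v w : word Gamma).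
Local Notation "w ~ w'" := (word_eq (@raag_relators Gamma) w w') (at level 70).

#[global] Instance word_eq_equiv : RelationClasses.Equivalence (word_eq (@raag_relators Gamma)).
Proof.
split; [exact: word_eq_refl | exact: word_eq_sym | exact: word_eq_trans].
Qed.

#[global] Instance word_eq_cat_proper :
  Morphisms.Proper (Morphisms.respectful (word_eq (@raag_relators Gamma))
    (Morphisms.respectful (word_eq (@raag_relators Gamma)) (word_eq (@raag_relators Gamma))))
    (@cat (Gamma * bool)).
Proof. by move=> u u' uu' v v' vv'; apply: word_eq_cat. Qed.

#[global] Instance word_eq_cons_proper :
  Morphisms.Proper (Morphisms.respectful eq
    (Morphisms.respectful (word_eq (@raag_relators Gamma)) (word_eq (@raag_relators Gamma))))
    (@cons (Gamma * bool)).
Proof.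
by move=> l _ <- v v' vv'; rewrite -(cat1s l v) -(cat1s l v') vv'; reflexivity.
Qed.

#[global] Instance word_eq_inv_proper :
  Morphisms.Proper (Morphisms.respectful (word_eq (@raag_relators Gamma))
    (word_eq (@raag_relators Gamma))) (@inv_word Gamma).
Proof. by move=> u u'; apply: word_eq_inv. Qed.

Lemma word_eq_linv l w : l :: linv l :: w ~ w.
Proof. by have := word_eq_cancel (@raag_relators Gamma) [::] w l.1 l.2; case: l. Qed.

Lemma word_eq_linvl l w : linv l :: l :: w ~ w.
Proof. by have := word_eq_linv (linv l) w; rewrite linvK. Qed.

(** The relators only speak of positive letters; the other signs follow by
  conjugating with the inverse letter. *)
Lemma word_eq_comm1 l m : edge l.1 m.1 -> [:: l; m] ~ [:: m; l].
Proof.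
have pos x y : edge x y -> [:: (x, false); (y, false)] ~ [:: (y, false); (x, false)].
  move=> xy.
  have := word_eq_relator [:: (y, false); (x, false)] [::]
    (ex_intro _ x (ex_intro _ y (conj xy erefl)) : @raag_relators Gamma _).
  rewrite cats0 /comm_word /=.
  rewrite (word_eq_linv (x, false)) (word_eq_linv (y, false)); exact.
have inv1 l1 m1 : [:: l1; m1] ~ [:: m1; l1] -> [:: linv l1; m1] ~ [:: m1; linv l1].
  move=> lm; rewrite -[X in _ ~ X](word_eq_linvl l1).
  rewrite -[l1 :: m1 :: _]/([:: l1; m1] ++ [:: linv l1]) lm /=.
  by rewrite (word_eq_linv l1 [::]); reflexivity.
move=> lm; have := pos _ _ lm; case: l m lm => [x b] [y e] /= _ xy.
have {}xy : [:: (x, false); (y, e)] ~ [:: (y, e); (x, false)].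
  by case: e => //; symmetry; apply: (inv1 (y, false)); symmetry.
by case: b => //; apply: (inv1 (x, false)).
Qed.

Lemma ldiv_word_eq l w : ldiv l w -> w ~ l :: rem l w.
Proof.
elim: w => //= m w IH; case: eqP => [-> _|_ /= /andP[lm /IH lw]]; first by reflexivity.
rewrite {1}lw -[m :: l :: _]/([:: m; l] ++ _) word_eq_comm1 1?edge_sym //.
reflexivity.
Qed.

Lemma trace_eq_word_eq w w' : w =t w' -> w ~ w'.
Proof.
elim: w w' => [|l w IH] w' ww'.
  by rewrite (trace_eq_nil (trace_eq_sym ww')); reflexivity.
have lw' : ldiv l w' by apply: trace_eq_ldiv; symmetry; exact: ww'.
rewrite (ldiv_word_eq lw'); rewrite -(IH (rem l w')); first by reflexivity.
by apply: (@trace_eq_consI _ l); rewrite ww'; apply: ldiv_trace_eq.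
Qed.

Definition reduced w := forall u l v, ~ w =t u ++ l :: linv l :: v.

Lemma reduced_trace_eq w w' : w =t w' -> reduced w -> reduced w'.
Proof. by move=> ww' rw u l v; rewrite -ww'; apply: rw. Qed.

Lemma reduced_catr u v : reduced (u ++ v) -> reduced v.
Proof. by move=> r a l b va; apply: (r (u ++ a) l b); rewrite va -catA; reflexivity. Qed.

Lemma reduced_nil : reduced [::].
Proof.
by move=> u l v E; have /(congr1 size) := trace_eq_nil (trace_eq_sym E); rewrite size_cat /= addnS.
Qed.

Lemma reduced_rem l w : ldiv l w -> reduced w -> reduced (rem l w).
Proof. by move=> /ldiv_trace_eq lw /(reduced_trace_eq lw); rewrite -cat1s => /reduced_catr. Qed.

Lemma reduced_ldiv l w : reduced (l :: w) -> ldiv (linv l) w = false.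
Proof.
by move=> r; apply/negP => /ldiv_trace_eq lw; apply: (r [::] l (rem (linv l) w)); rewrite {1}lw.
Qed.

(** In a cancelling pair of [l :: w], either [l] divides what precedes the pair,
  or commutes with it and divides what follows, and then the pair was already in
  [w]; or [l] belongs to the pair, and then its partner divides [w]. *)
Lemma reduced_cons l w : reduced w -> ldiv (linv l) w = false -> reduced (l :: w).
Proof.
move=> rw lw u m v lwE.
have: ldiv l (u ++ m :: linv m :: v) by apply: trace_eq_ldiv; symmetry; exact: lwE.
rewrite ldiv_cat /= => /orP[/ldiv_trace_eq lu|/andP[lu]].
  by apply: (rw (rem l u) m v); apply: (@trace_eq_consI _ l); rewrite lwE {1}lu; reflexivity.
case: eqP => [ml _|/eqP ml /= /andP[lm]].
  move/negP: lw; apply; apply: (@trace_eq_ldiv _ _ _ (u ++ v)).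
  apply: (@trace_eq_consI _ l); rewrite lwE ml -(cat_cons _ _ v).
  rewrite (@trace_eq_swapl _ (linv l) u) // -catA /= -(cat_cons _ _ (_ :: v)).
  by rewrite (trace_eq_swapl lu) -catA /=; reflexivity.
case: eqP => [ml' _|/eqP ml' /= /andP[_ /ldiv_trace_eq lv]].
  by rewrite -ml' /= edge_irrefl in lm.
apply: (rw u m (rem l v)); apply: (@trace_eq_consI _ l); rewrite lwE {1}lv.
rewrite -(cat_cons l u) (trace_eq_swapl lu) -catA /=.
rewrite -[l :: m :: linv m :: _]/((l :: [:: m; linv m]) ++ _).
by rewrite (@trace_eq_swapl _ l [:: m; linv m]) //= lm.
Qed.

(** Left multiplication by a letter on reduced words.  It is an action of the
  group on reduced traces, which solves the word problem. *)
Definition push l w := if ldiv (linv l) w then rem (linv l) w else l :: w.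

Definition normal_form w := foldr push [::] w.

Lemma push_trace_eq l w w' : w =t w' -> push l w =t push l w'.
Proof.
move=> ww'; rewrite /push -(ldiv_proper (linv l) ww').
case: ifP => lw; last by rewrite ww'; reflexivity.
apply: (@trace_eq_consI _ (linv l)); rewrite -!ldiv_trace_eq //.
by rewrite -(ldiv_proper (linv l) ww').
Qed.

Lemma push_reduced l w : reduced w -> reduced (push l w).
Proof. by move=> rw; rewrite /push; case: ifPn => [/reduced_rem|/negbTE/reduced_cons]; apply. Qed.

Lemma pushK l w : reduced w -> push l (push (linv l) w) =t w.
Proof.
move=> rw; rewrite {2}/push linvK; case: ifPn => [lw|_]; last first.
  by rewrite /push /= eqxx.
have := reduced_trace_eq (ldiv_trace_eq lw) rw => /reduced_ldiv lw'.
by rewrite /push lw' -ldiv_trace_eq.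
Qed.

Lemma ldiv_rem l m w : edge l.1 m.1 -> ldiv m w -> ldiv l (rem m w) = ldiv l w.
Proof.
move=> lm mw; rewrite [RHS](ldiv_proper _ (ldiv_trace_eq mw)) /= lm.
by case: eqP => // E; rewrite E edge_irrefl in lm.
Qed.

Lemma ldiv_consC l m w : edge l.1 m.1 -> ldiv l (m :: w) = ldiv l w.
Proof. by move=> lm /=; rewrite lm; case: eqP => // E; rewrite E edge_irrefl in lm. Qed.

Lemma rem_consC l m w : edge l.1 m.1 -> rem l (m :: w) = m :: rem l w.
Proof. by move=> lm /=; case: eqP => // E; rewrite E edge_irrefl in lm. Qed.

Lemma pushC l m w : edge l.1 m.1 -> push l (push m w) =t push m (push l w).
Proof.
move=> lm; have ml : edge m.1 l.1 by rewrite edge_sym.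
have E : [:: l; m] =t [:: m; l] by apply: trace_eq_swap1.
rewrite /push; case: (boolP (ldiv (linv l) w)) => lw; case: (boolP (ldiv (linv m) w)) => mw.
- rewrite !ldiv_rem // lw mw; apply: (@trace_eq_consI _ (linv l)); apply: (@trace_eq_consI _ (linv m)).
  transitivity w; first by rewrite -!ldiv_trace_eq ?ldiv_rem //; reflexivity.
  rewrite -[linv m :: _]/([:: linv m; linv l] ++ _) (@trace_eq_swap1 _ (linv m) (linv l)) //=.
  by rewrite -!ldiv_trace_eq ?ldiv_rem //; reflexivity.
- by rewrite ldiv_consC // lw ldiv_rem // (negbTE mw) rem_consC //; reflexivity.
- by rewrite ldiv_rem // (negbTE lw) ldiv_consC // mw rem_consC //; reflexivity.
- rewrite !ldiv_consC // (negbTE lw) (negbTE mw).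
  by rewrite -[l :: m :: w]/([:: l; m] ++ w) E; reflexivity.
Qed.

Lemma normal_form_reduced w : reduced (normal_form w).
Proof. by elim: w => [|l w IH] /=; [exact: reduced_nil | exact: push_reduced]. Qed.

Lemma foldr_push_trace_eq u w w' : w =t w' -> foldr push w u =t foldr push w' u.
Proof. by elim: u => //= l u IH /IH; apply: push_trace_eq. Qed.

(** [push] satisfies the defining relations of the group, so equal elements act
  equally on the empty word. *)
Lemma word_eq_normal_form w w' : w ~ w' -> normal_form w =t normal_form w'.
Proof.
elim=> [v|v v' _|v v' v'' _ + _|v v' x b|v v' _ [x [y [xy ->]]]].
- by reflexivity.
- by symmetry.
- by move=> ->.
- rewrite /normal_form !foldr_cat; apply: foldr_push_trace_eq => /=.
  exact: (pushK (x, b) (@normal_form_reduced v')).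
- rewrite /normal_form !foldr_cat; apply: foldr_push_trace_eq => /=.
  rewrite -/(normal_form v'); have rv := @normal_form_reduced v'.
  transitivity (push (x, true) (push (x, false) (push (y, true) (push (y, false) (normal_form v'))))).
    by do !apply: push_trace_eq; apply: pushC; rewrite /= edge_sym.
  have Ey := pushK (y, true) rv.
  rewrite -[X in _ =t X]Ey; apply: (pushK (x, true)).
  by do 2 apply: push_reduced.
Qed.

Lemma normal_form_id w : reduced w -> normal_form w = w.
Proof.
elim: w => //= l w IH rlw.
by rewrite (IH (@reduced_catr [:: l] w rlw)) /push reduced_ldiv.
Qed.

Lemma reduced_uniq w w' : reduced w -> reduced w' -> w ~ w' -> w =t w'.
Proof. by move=> rw rw' /word_eq_normal_form; rewrite !normal_form_id. Qed.

Lemma normal_form_word_eq w : normal_form w ~ w.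
Proof.
elim: w => [|l w IH]; first by reflexivity.
rewrite /= /push; case: ifPn => [|_]; last by rewrite IH; reflexivity.
move=> /ldiv_word_eq lw; rewrite -[X in _ ~ l :: X]IH [X in _ ~ l :: X]lw.
by rewrite word_eq_linv; reflexivity.
Qed.

Lemma normal_form_subseq w : subseq (normal_form w) w.
Proof.
elim: w => [|l w IH] //=; rewrite /push; case: ifP => _; last by rewrite /= eqxx.
by apply: subseq_trans (subseq_cons _ _); apply: subseq_trans (rem_subseq _ _) IH.
Qed.

Lemma inv_word_cons l w : inv_word (l :: w) = inv_word w ++ [:: linv l].
Proof. by rewrite -cat1s inv_word_cat. Qed.

Lemma inv_word_trace_eq u v : u =t v -> inv_word u =t inv_word v.
Proof.
move=> uv x y /uv /(congr1 (@inv_word _)).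
by rewrite /proj /inv_word !filter_rev !filter_map.
Qed.

(** The product of two reduced words becomes reduced once the largest suffix of
  the first that is inverse to a prefix of the second is cancelled. *)
Lemma reduced_mul g k : reduced g -> reduced k -> exists a c k1,
  [/\ g =t a ++ inv_word c, k =t c ++ k1 & reduced (a ++ k1)].
Proof.
elim: g => [|l g IH] rg rk.
  by exists [::], [::], k; split=> //; reflexivity.
have [|a [c [k1 [gac kc r]]]] := IH _ rk; first exact: (@reduced_catr [:: l] g rg).
case: (boolP (ldiv (linv l) (a ++ k1))) => [|/negbTE lak]; last first.
  by exists (l :: a), c, k1; split=> //; [rewrite gac; reflexivity|exact: reduced_cons].
rewrite ldiv_cat => /orP[la|/andP[la /ldiv_trace_eq lk]].
  suff: ldiv (linv l) g by rewrite reduced_ldiv.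
  by rewrite (ldiv_proper _ gac) ldiv_cat la.
exists a, (c ++ [:: linv l]), (rem (linv l) k1); split.
- have -> : inv_word (c ++ [:: linv l]) = l :: inv_word c.
    by rewrite inv_word_cat inv_word_cons linvK.
  by rewrite gac -cat_cons (@trace_eq_swapl _ l a) // -catA; reflexivity.
- by rewrite kc -catA /= -lk; reflexivity.
- have: a ++ k1 =t linv l :: (a ++ rem (linv l) k1).
    by rewrite {1}lk -(cat_cons (linv l)) (trace_eq_swapl la) -catA; reflexivity.
  by move=> /reduced_trace_eq/(_ r); rewrite -cat1s => /reduced_catr.
Qed.

End Reduced.

(** * Star length, and prefixes of a trace sharing a window *)

Section StarLength.
Variable Gamma : sgraph.
Implicit Types (x y z : Gamma) (l m : Gamma * bool) (a b c d u v w : word Gamma).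

Definition star z : pred Gamma := fun x => (x == z) || edge z x.

(** The empty word is included separately so that it is short even when [Gamma]
  has no vertex. *)
Definition in_star w := w = [::] \/ exists z, all (fun l => star z l.1) w.

Fixpoint star_le n w : Prop :=
  if n is n'.+1 then exists s v, [/\ in_star s, star_le n' v & w =t s ++ v] else w = [::].

Lemma in_star_sub u w : {subset u <= w} -> in_star w -> in_star u.
Proof.
move=> uw [w0|[z wz]]; last by right; exists z; apply/allP => l /uw; apply: (allP wz).
by left; case: u uw => // l u /(_ l); rewrite mem_head w0 => /(_ isT).
Qed.

(** A nonempty word confines everything that commutes with it to the star of any
  of its letters; this is how the short pieces in a Levi square arise. *)
Lemma indep_in_star u v : indep u v -> v != [::] -> in_star u.
Proof.
case: v => // m v /indepP uv _; right; exists m.1; apply/allP => l lu.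
by rewrite /star edge_sym uv ?orbT // mem_head.
Qed.

Lemma star_le_trace_eq n w w' : w =t w' -> star_le n w -> star_le n w'.
Proof.
case: n => [/= /[swap] ->|n ww' [s [v [ss sv wE]]]].
  by move=> /trace_eq_sym/trace_eq_nil.
by exists s, v; split=> //; rewrite -ww'.
Qed.

Lemma star_le_nil n : star_le n [::].
Proof. by elim: n => //= n IH; exists [::], [::]; split=> //; left. Qed.

Lemma star_le_cat i j u v : star_le i u -> star_le j v -> star_le (i + j) (u ++ v).
Proof.
move=> + sv; elim: i u => [|i IH] u /=; first by move=> ->.
move=> [s [t [ss /IH st uE]]]; exists s, (t ++ v); split=> //.
by rewrite uE -catA; reflexivity.
Qed.

Lemma star_le_mono i j w : i <= j -> star_le i w -> star_le j w.
Proof.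
move=> /subnKC <- /star_le_cat/(_ (star_le_nil (j - i))).
by rewrite cats0.
Qed.

Lemma star_le1 s : in_star s -> star_le 1 s.
Proof. by move=> ss; exists s, [::]; split=> //; rewrite cats0; reflexivity. Qed.

Lemma star_le_split i j w : star_le (i + j) w ->
  exists u v, [/\ star_le i u, star_le j v & w =t u ++ v].
Proof.
elim: i w => [|i IH] w /=; first by exists [::], w; split=> //; reflexivity.
move=> [s [t [ss /IH[u [v [su sv tE]]] wE]]].
exists (s ++ u), v; split=> //; last by rewrite wE tE catA; reflexivity.
by exists s, u; split=> //; reflexivity.
Qed.

Lemma trace_eq_sub u v w : w =t u ++ v -> {subset u <= w} /\ {subset v <= w}.
Proof.
by move=> /trace_eq_mem E; split=> l lu; rewrite E mem_cat lu ?orbT.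
Qed.

(** By the Levi lemma a decomposition into star words restricts to prefixes and
  suffixes. *)
Lemma star_le_factor n u v : star_le n (u ++ v) -> star_le n u /\ star_le n v.
Proof.
elim: n u v => [|n IH] u v /=; first by case: u => //= ->.
move=> [s [t [ss st /levi[p [q [r [e [uE vE sE tE qr]]]]]]]].
have [ps rs] := trace_eq_sub sE.
have [sq se] := IH q e (star_le_trace_eq tE st).
split; first by exists p, q; split=> //; apply: in_star_sub ss.
by exists r, e; split=> //; apply: in_star_sub ss.
Qed.

Lemma star_le_subseq n w : star_le n w ->
  exists2 w', w =t w' & forall u, subseq u w' -> star_le n u.
Proof.
elim: n w => [w /= ->|n IH w /= [s [v [ss /IH[v' vv' sv'] wE]]]].
  by exists [::] => [|u]; [reflexivity|rewrite subseq0 => /eqP].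
exists (s ++ v'); first by rewrite wE vv'; reflexivity.
move=> u /subseqP[m]; rewrite size_cat => sm ->.
rewrite -(cat_take_drop (size s) m) mask_cat ?size_takel ?sm ?leq_addr //.
exists (mask (take (size s) m) s), (mask (drop (size s) m) v'); split.
- by apply: in_star_sub ss => l; apply: mem_mask.
- by apply: sv'; apply: mask_subseq.
- by reflexivity.
Qed.

(** Reduction only deletes letters, so it cannot increase the star length. *)
Lemma star_le_normal_form n w : star_le n w -> star_le n (normal_form w).
Proof.
move=> /star_le_subseq[w' ww' sw']; apply: star_le_trace_eq (sw' _ (normal_form_subseq w')).
by apply: word_eq_normal_form; symmetry; apply: trace_eq_word_eq.
Qed.

Lemma in_star_inv w : in_star w -> in_star (inv_word w).
Proof.
move=> [->|[z wz]]; [by left|right; exists z].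
by rewrite /inv_word all_rev all_map.
Qed.

Lemma star_le_inv n w : star_le n w -> star_le n (inv_word w).
Proof.
elim: n w => [w -> //|n IH w [s [v [ss /IH sv wE]]]].
apply: (@star_le_trace_eq _ (inv_word v ++ inv_word s)).
  by rewrite -inv_word_cat; symmetry; apply: inv_word_trace_eq.
by rewrite -addn1; apply: star_le_cat => //; apply/star_le1/in_star_inv.
Qed.

Definition occ x w := count (fun l => l.1 == x) w.

Lemma occ_cat x u v : occ x (u ++ v) = occ x u + occ x v.
Proof. exact: count_cat. Qed.

Lemma occ_projl x y w : occ x (proj x y w) = occ x w.
Proof. by rewrite /occ count_filter; apply: eq_count => l /=; case: eqP. Qed.

Lemma occ_projr x y w : occ y (proj x y w) = occ y w.
Proof. by rewrite /occ count_filter; apply: eq_count => l /=; case: eqP; rewrite ?orbT. Qed.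

Lemma occ_trace_eq x u v : u =t v -> occ x u = occ x v.
Proof. by move=> uv; rewrite -(occ_projl x x) uv ?edge_irrefl // occ_projl. Qed.

Definition tprefix u w := exists v, w =t u ++ v.

Lemma tprefix_catl k W e : tprefix (e ++ W) k -> tprefix e k.
Proof. by move=> [r kr]; exists (W ++ r); rewrite catA. Qed.

(** Both projections are prefixes of the same word on two letters. *)
Lemma tprefix_proj k p f x y : tprefix p k -> tprefix f k -> ~~ edge x y ->
  (exists s, proj x y f = proj x y p ++ s) \/ (exists s, proj x y p = proj x y f ++ s).
Proof.
move=> [r kr] [s ks] xy; have := kr x y xy; rewrite (ks x y xy) !proj_cat => E.
case/orP: (leq_total (size (proj x y p)) (size (proj x y f))) => le; [left|right].
  exists (drop (size (proj x y p)) (proj x y f)); rewrite -[LHS](cat_take_drop (size (proj x y p))).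
  by congr (_ ++ _); have /(congr1 (take (size (proj x y p)))) := E; rewrite takel_cat // take_size_cat.
exists (drop (size (proj x y f)) (proj x y p)); rewrite -[LHS](cat_take_drop (size (proj x y f))).
by congr (_ ++ _); have /(congr1 (take (size (proj x y f)))) := esym E; rewrite takel_cat // take_size_cat.
Qed.

(** By comparability, [f] cannot be ahead of [p] in [y] and behind it in [x]. *)
Lemma tprefix_lt k p f x y : tprefix p k -> tprefix f k -> ~~ edge x y ->
  occ y p < occ y f -> occ x p <= occ x f.
Proof.
move=> pp pf xy; rewrite -(occ_projl x y p) -(occ_projl x y f) -(occ_projr x y p) -(occ_projr x y f).
by case: (tprefix_proj pp pf xy) => -[m ->]; rewrite !occ_cat; lia.
Qed.

Lemma tprefix_eq k p f : tprefix p k -> tprefix f k -> (forall x, occ x p = occ x f) -> p =t f.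
Proof.
move=> pp pf E x y xy.
have nil (s : word Gamma) : all (fun l => (l.1 == x) || (l.1 == y)) s ->
    occ x s = 0 -> occ y s = 0 -> s = [::].
  by case: s => //= l m /andP[/orP[] ->].
have aproj w : all (fun l => (l.1 == x) || (l.1 == y)) (proj x y w) by exact: filter_all.
have := E x; have := E y.
rewrite -(occ_projl x y p) -(occ_projl x y f) -(occ_projr x y p) -(occ_projr x y f).
case: (tprefix_proj pp pf xy) => -[m mE]; rewrite !mE !occ_cat => ey ex.
- have := aproj f; rewrite mE all_cat => /andP[_ /nil ->]; rewrite ?cats0 //; lia.
- have := aproj p; rewrite mE all_cat => /andP[_ /nil ->]; rewrite ?cats0 //; lia.
Qed.

(** Say that the projection of [f] is that of [e] followed by [m], where [m]
  contains no [x].  Then the projections of [W] and of [m ++ W] start the same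
  word, so that their first [x] is at the same place, and [m] is empty. *)
Lemma tprefix_window k W e f x y : tprefix (e ++ W) k -> tprefix (f ++ W) k -> ~~ edge x y ->
  0 < occ x W -> occ x e = occ x f -> occ y e = occ y f.
Proof.
wlog : e f / exists s, proj x y f = proj x y e ++ s => [wl|].
  move=> ek fk xy xW ef.
  have [em|fm] := tprefix_proj (tprefix_catl ek) (tprefix_catl fk) xy; first exact: wl.
  by apply/esym; apply: wl.
move=> [m fE] [r kr] [s ks] xy xW ef.
have m0 : occ x m = 0.
  by have := ef; rewrite -(occ_projl x y f) -(occ_projl x y e) fE occ_cat; lia.
suff m_nil : m = [::].
  by rewrite -(occ_projr x y f) -(occ_projr x y e) fE m_nil cats0.
have := ks x y xy; rewrite (kr x y xy) !proj_cat fE -!catA => /eqP.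
rewrite eqseq_cat // eqxx /= => /eqP /(congr1 (find (fun l => l.1 == x))).
have hW : has (fun l => l.1 == x) (proj x y W) by rewrite has_count -/(occ x _) occ_projl.
have hm : has (fun l => l.1 == x) m = false by rewrite has_count -/(occ x _) m0.
by rewrite !find_cat hW hm => E; apply: size0nil; lia.
Qed.

Lemma trace_eq_partition (P : pred Gamma) w :
    (forall l m, l \in w -> m \in w -> ~~ P l.1 -> P m.1 -> edge l.1 m.1) ->
  w =t [seq l <- w | P l.1] ++ [seq l <- w | ~~ P l.1].
Proof.
elim: w => [_|l w IH lmw] /=; first by reflexivity.
have {}IH := IH (fun m n mw nw =>
  lmw m n (@mem_behead _ (l :: w) m mw) (@mem_behead _ (l :: w) n nw)).
case: ifPn => Pl /=; first by rewrite {1}IH; reflexivity.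
rewrite {1}IH -cat_cons (@trace_eq_swapl _ l) -?catA; first by reflexivity.
apply/allP => m; rewrite mem_filter => /andP[Pm mw].
by apply: lmw => //; rewrite ?mem_head // in_cons mw orbT.
Qed.

Lemma sub_in_count (T : eqType) (P Q : pred T) (s : seq T) :
  {in s, subpred P Q} -> count P s <= count Q s.
Proof.
move=> PQ; rewrite (@eq_in_count _ P (predI P Q)) => [|x xs /=].
  by apply: sub_count => x /andP[].
by case: (boolP (P x)) => // /(PQ x xs) ->.
Qed.

Section Window.
Variables (k W : word Gamma).
Hypothesis W_long : ~ star_le 2 W.

Let noncomm : rel Gamma := fun x y => [&& ~~ edge x y, 0 < occ x W & 0 < occ y W].

Lemma occ_gt0 l : l \in W -> 0 < occ l.1 W.
Proof. by move=> lW; rewrite -has_count; apply/hasP; exists l. Qed.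

(** Otherwise [W] is the product of a word in the component of [x], all of which
  commutes with [y], and of a word outside it, all of which commutes with [x]. *)
Lemma noncomm_connect x y : 0 < occ x W -> 0 < occ y W -> connect noncomm x y.
Proof.
move=> xW yW; apply: contra_notT W_long => xy.
have commP l : l \in W -> connect noncomm x l.1 -> edge y l.1.
  move=> lW xl; apply: contraT => yl; case/negP: xy; apply: connect_trans xl _.
  by apply: connect1; rewrite /noncomm edge_sym yl occ_gt0.
have commN l : l \in W -> ~~ connect noncomm x l.1 -> edge x l.1.
  move=> lW; apply: contraR => xl; apply: connect1.
  by rewrite /noncomm xl xW occ_gt0.
apply: (@star_le_trace_eq _ ([seq l <- W | connect noncomm x l.1] ++
                             [seq l <- W | ~~ connect noncomm x l.1])).
  symmetry; apply: trace_eq_partition => l m lW mW xl xm; apply: contraT => lm.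
  case/negP: xl; apply: connect_trans xm _; apply: connect1.
  by rewrite /noncomm edge_sym lm !occ_gt0.
apply: (@star_le_cat 1 1); apply: star_le1; right.
  exists y; apply/allP => l; rewrite mem_filter => /andP[xl lW].
  by rewrite /star commP ?orbT.
exists x; apply/allP => l; rewrite mem_filter => /andP[xl lW].
by rewrite /star commN ?orbT.
Qed.

Lemma not_in_star_W z : exists2 x, 0 < occ x W & ~~ star z x.
Proof.
have : ~~ all (fun l => star z l.1) W.
  apply: contra_notN W_long => az; apply: (@star_le_mono 1) => //.
  by apply: star_le1; right; exists z.
by case/allPn => l lW zl; exists l.1 => //; apply: occ_gt0.
Qed.

(** The equality of numbers of letters spreads from [x] to the support of [W],
  and from there to every vertex [y], because some element of that support is
  neither equal nor adjacent to [y]. *)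
Lemma window_inj e f x : tprefix (e ++ W) k -> tprefix (f ++ W) k ->
  0 < occ x W -> occ x e = occ x f -> e =t f.
Proof.
move=> ek fk xW ef.
have efW y : 0 < occ y W -> occ y e = occ y f.
  move=> yW; case/connectP: (noncomm_connect xW yW) => p + ->.
  elim: p x xW ef => //= z p IH x xW ef /andP[/and3P[xz _ zW]] /IH; apply=> //.
  exact: tprefix_window ek fk xz xW ef.
apply: (tprefix_eq (tprefix_catl ek) (tprefix_catl fk)) => y.
have [z zW yz] := not_in_star_W y.
move: yz; rewrite /star negb_or => /andP[_ yz].
by apply: (tprefix_window ek fk _ zW (efW z zW)); rewrite edge_sym.
Qed.

Variables (T : eqType) (S : seq T) (E : T -> word Gamma).
Hypothesis S_uniq : uniq S.
Hypothesis E_inj : {in S &, forall g h, E g =t E h -> g = h}.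
Hypothesis E_pre : {in S, forall g, tprefix (E g ++ W) k}.

Let below x p := count (fun g => occ x (E g) < occ x p) S.

(** By [window_inj], different elements of [S] have different numbers of [x]. *)
Lemma level_le1 x n : 0 < occ x W -> count (fun g => occ x (E g) == n) S <= 1.
Proof.
move=> xW; rewrite -[count _ _](@count_map _ _ (fun g => occ x (E g)) (pred1 n)).
rewrite count_uniq_mem ?leq_b1 // map_inj_in_uniq // => g h gS hS gh.
apply: (E_inj gS hS); exact: (window_inj (E_pre gS) (E_pre hS) xW gh).
Qed.

(** If [E g] is behind [p] in [x], it is not ahead of [p] in [y]; by [level_le1]
  it can draw level for one [g] only. *)
Lemma below_step p x y : tprefix p k -> noncomm x y -> below x p <= (below y p).+1.
Proof.
move=> pk /and3P[xy xW yW]; rewrite -addn1.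
apply: leq_trans (leq_add (leqnn _) (level_le1 (occ y p) yW)).
rewrite -count_predUI; apply: leq_trans (leq_addr _ _).
apply: sub_in_count => g gS /= lt; rewrite orbC -leq_eqVlt leqNgt.
apply/negP => /(tprefix_lt pk (tprefix_catl (E_pre gS)) xy).
by rewrite leqNgt lt.
Qed.

Lemma below_connect p x y : tprefix p k -> 0 < occ x W -> 0 < occ y W ->
  below x p <= below y p + #|Gamma|.
Proof.
move=> pk xW yW; case/connectP: (noncomm_connect xW yW) => q0 /shortenP[q pq uq _] -> {q0 y yW}.
suff: below x p <= below (last x q) p + size q.
  move=> /leq_trans; apply; rewrite leq_add2l.
  by have := max_card (mem (x :: q)); rewrite (card_uniqP uq) => /ltnW.
elim: q x {xW uq} pq => [|z q IH] x /=; first by rewrite addn0.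
move=> /andP[xz /IH le]; apply: leq_trans (below_step pk xz) _.
by rewrite addnS ltnS.
Qed.

(** Each star word misses some [y] in the support of [W], for which [below] does
  not change; the other letters of [W] follow [y] up to [#|Gamma|]. *)
Lemma below_star_le n p w B : star_le n w -> tprefix (p ++ w) k ->
  (forall x, 0 < occ x W -> below x p <= B) ->
  forall x, 0 < occ x W -> below x (p ++ w) <= B + n * #|Gamma|.
Proof.
elim: n p w B => [|n IH] p w B /= => [->|[s [v [ss sv wE]]]] pwk pB x xW.
  by rewrite cats0 addn0 pB.
have pE : p ++ w =t (p ++ s) ++ v by rewrite wE catA; reflexivity.
have psvk : tprefix ((p ++ s) ++ v) k by have [r kr] := pwk; exists r; rewrite kr pE; reflexivity.
have belowE z q q' : q =t q' -> below z q = below z q'.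
  by move=> qq'; rewrite /below (occ_trace_eq z qq').
rewrite (belowE _ _ _ pE) mulSn addnA.
apply: IH => // z zW.
(* the letter of the window that the star word [s] does not move *)
have [y yW ys] : exists2 y, 0 < occ y W & occ y s = 0.
  have [y0 y0W _] := not_in_star_W x.
  case: ss => [->|[c sc]]; first by exists y0.
  have [y yW yc] := not_in_star_W c; exists y => //.
  apply/eqP; rewrite -leqn0 leqNgt -has_count; apply/hasPn => l /(allP sc).
  by apply: contraL => /eqP ->.
apply: leq_trans (below_connect (tprefix_catl psvk) zW yW) _; rewrite leq_add2r.
by rewrite /below occ_cat ys addn0 pB.
Qed.

(** The element of [S] that is most advanced is ahead of all the others, while
  being a short prefix it cannot be ahead of many. *)
Lemma window_card n : {in S, forall g, star_le n (E g)} -> size S <= (n * #|Gamma|).+1.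
Proof.
move=> Sn; have [x xW _] : exists2 x, 0 < occ x W & true.
  case: W W_long => [|l w _]; first by case; exact: star_le_nil.
  by exists l.1 => //=; rewrite eqxx.
have [->|S0] := eqVneq S [::]; first by [].
have [g gS gmax] : exists2 g, g \in S & {in S, forall h, occ x (E h) <= occ x (E g)}.
  case: S S0 => // h s _; elim: s h => [|h' s IH] h.
    by exists h => [|h']; rewrite ?mem_head // inE => /eqP ->.
  have [g gs gm] := IH h'; have [le|lt] := leqP (occ x (E h)) (occ x (E g)).
    by exists g => [|f]; rewrite in_cons ?gs ?orbT // => /orP[/eqP->|/gm].
  exists h => [|f]; rewrite ?mem_head // in_cons => /orP[/eqP->//|/gm /leq_trans]; apply.
  exact: ltnW.
have gk := tprefix_catl (E_pre gS).
have : below x (E g) <= 0 + n * #|Gamma|.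
  apply: (@below_star_le n [::] (E g) 0) => // [|y yW]; first exact: Sn.
  by rewrite /below /occ /= leqn0; apply/eqP/count_pred0.
rewrite add0n => le; rewrite -(count_predC (fun h => occ x (E h) < occ x (E g))) -addn1.
apply: leq_add => //; apply: leq_trans (level_le1 (occ x (E g)) xW).
by apply: sub_in_count => h hS /=; rewrite -leqNgt => ?; rewrite eqn_leq gmax.
Qed.

End Window.
End StarLength.

(** * Quadrilaterals and centralizers *)

Section Quad.
Variable Gamma : sgraph.
Implicit Types (x y z : Gamma) (l m : Gamma * bool) (a b c d u v w k : word Gamma).
Local Notation "w ~ w'" := (word_eq (@raag_relators Gamma) w w') (at level 70).

Lemma star_le_size w : star_le (size w) w.
Proof.
elim: w => //= l w IH; exists [:: l], w; split=> //.
by right; exists l.1; rewrite /= /star eqxx.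
Qed.

(** In the Levi square of the two factorizations, a nonempty [r] would force [u]
  to be a prefix of [a] followed by a star word. *)
Lemma tprefix_of_short n u v a b : star_le n a -> ~ star_le n.+1 u -> u ++ v =t a ++ b ->
  exists a', u =t a ++ a'.
Proof.
move=> sa su /levi[p [q [r [s [uE vE aE bE qr]]]]].
have [r0|r0] := eqVneq r [::].
  by exists q; rewrite uE aE r0 cats0; reflexivity.
case: su; rewrite -addn1; apply: (@star_le_trace_eq _ _ (p ++ q)); first by symmetry.
apply: star_le_cat; first by have [] := star_le_factor (star_le_trace_eq aE sa).
by apply/star_le1/(indep_in_star qr).
Qed.

Lemma tsuffix_of_short n u v a b : star_le n b -> ~ star_le n.+1 v -> u ++ v =t a ++ b ->
  exists b', v =t b' ++ b.
Proof.
move=> sb sv /levi[p [q [r [s [uE vE aE bE qr]]]]].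
have [q0|q0] := eqVneq q [::].
  by exists r; rewrite vE bE q0; reflexivity.
case: sv; rewrite -add1n; apply: (@star_le_trace_eq _ _ (r ++ s)); first by symmetry.
apply: star_le_cat; last by have [] := star_le_factor (star_le_trace_eq bE sb).
by apply/star_le1/(@indep_in_star _ _ q) => //; rewrite indep_sym.
Qed.

(** Cut a shortest decomposition of [k] into star words after [n + 2] factors
  from either end; the three parts cannot be shortened. *)
Lemma star_le_window n k : ~ star_le (2 * n + 6) k -> exists u0 W u1,
  [/\ k =t u0 ++ W ++ u1, star_le (n + 2) u0, ~ star_le n.+1 u0, ~ star_le 2 W
    & ~ star_le n.+1 u1].
Proof.
move=> kN; have ex : exists i, `[< star_le i k >] by exists (size k); apply/asboolP/star_le_size.
case: (ex_minnP ex) => M /asboolP kM Mmin.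
have {}Mmin i : star_le i k -> M <= i by move=> /asboolP; apply: Mmin.
have ltM : 2 * n + 6 < M by rewrite ltnNge; apply/negP => /star_le_mono/(_ kM).
have ME : M = (n + 2) + ((M - 2 * n - 4) + (n + 2)) by lia.
move: kM; rewrite ME => /star_le_split[u0 [v [su0 /star_le_split[W [u1 [sW su1 vE]]] kE]]].
have {vE}kE : k =t u0 ++ W ++ u1 by rewrite kE vE; reflexivity.
have long i j h : star_le i u0 -> star_le j W -> star_le h u1 -> M <= i + (j + h).
  move=> si sj sh; apply: Mmin; apply: star_le_trace_eq (trace_eq_sym kE) _.
  by do !apply: star_le_cat.
exists u0, W, u1; split=> // [s|s|s].
- have := long _ _ _ s sW su1; lia.
- have := long _ _ _ su0 s su1; lia.
- have := long _ _ _ su0 sW s; lia.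
Qed.

(** The two reduced forms [a ++ k1] of [g k] and [a2 ++ d] of [k g'] are the same
  trace.  In their Levi square the piece [q] is trivial, for otherwise the common
  middle part [r] of [k] would lie in a star and [k] would be short.  So
  [k = a r b = c r d] with [a] a prefix of [u0] and [b] a suffix of [u1]; hence
  [r] contains [W], and reading [W] off the second factorization gives [e]. *)
Lemma quadrilateral n k u0 W u1 g g' :
    k =t u0 ++ W ++ u1 -> star_le (n + 2) u0 -> ~ star_le n.+1 u0 -> ~ star_le n.+1 u1 ->
    ~ star_le (2 * n + 6) k -> reduced k -> reduced g -> reduced g' ->
    star_le n g -> star_le n g' ->
    g ++ k ~ k ++ g' ->
  exists e, [/\ g ++ e ~ u0, star_le (2 * n + 2) e & tprefix (e ++ W) k].
Proof.
move=> kE su0 nu0 nu1 nk rk rg rg' sg sg' gk.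
have [a [c [k1 [gE kck1 rak1]]]] := reduced_mul rg rk.
have [a2 [c2 [d [ka2c2 g'E ra2d]]]] := reduced_mul rk rg'.
have ak1 : a ++ k1 =t a2 ++ d.
  apply: (reduced_uniq rak1 ra2d).
  transitivity (g ++ k).
    rewrite (trace_eq_word_eq gE) (trace_eq_word_eq kck1) -catA (catA (inv_word c)).
    by rewrite (word_eq_mulVg _ c); reflexivity.
  rewrite gk (trace_eq_word_eq ka2c2) (trace_eq_word_eq g'E) -catA (catA (inv_word c2)).
  by rewrite (word_eq_mulVg _ c2); reflexivity.
have [p [q [r [s [aE k1E a2E dE qr]]]]] := levi ak1.
have [sa sVc] := star_le_factor (star_le_trace_eq gE sg).
have [sc2 sdd] := star_le_factor (star_le_trace_eq g'E sg').
have sc : star_le n c by have := star_le_inv sVc; rewrite inv_wordK.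
(* otherwise [k = c r s] has star length at most [n + 1 + n] *)
have q0 : q = [::].
  apply/eqP; apply: contra_notT nk => q0.
  apply: (@star_le_trace_eq _ _ (c ++ r ++ s)); first by rewrite kck1 k1E; reflexivity.
  apply: (@star_le_mono _ (n + (1 + n))); first by lia.
  apply: star_le_cat sc (star_le_cat _ _); first by apply/star_le1/(@indep_in_star _ _ q); rewrite 1?indep_sym.
  by have [] := star_le_factor (star_le_trace_eq dE sdd).
rewrite q0 /= cats0 in aE dE.
have k2E : k =t a ++ r ++ inv_word c2.
  by rewrite ka2c2 a2E aE catA; reflexivity.
have [|a' u0E] := @tprefix_of_short n u0 (W ++ u1) a (r ++ inv_word c2) sa nu0.
  by rewrite -kE.
have [|b' u1E] := @tsuffix_of_short n (u0 ++ W) u1 (a ++ r) (inv_word c2) (star_le_inv sc2) nu1.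
  by rewrite -!catA -kE.
have rE : r =t a' ++ W ++ b'.
  apply: (@trace_eq_catIr _ (inv_word c2)); apply: (@trace_eq_catIl _ a).
  by rewrite -k2E kE u0E u1E -!catA; reflexivity.
exists (c ++ a'); split.
- rewrite (trace_eq_word_eq gE) (trace_eq_word_eq u0E) -catA (catA (inv_word c)).
  by rewrite (word_eq_mulVg _ c); reflexivity.
- apply: (@star_le_mono _ (n + (n + 2))); first by lia.
  by apply: star_le_cat => //; have [] := star_le_factor (star_le_trace_eq u0E su0).
- by exists (b' ++ s); rewrite kck1 k1E rE -!catA; reflexivity.
Qed.

Lemma reduced_inv w : reduced w -> reduced (inv_word w).
Proof.
move=> rw u l v /inv_word_trace_eq; rewrite inv_wordK inv_word_cat !inv_word_cons.
by rewrite linvK -!catA /=; apply: rw.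
Qed.

Lemma star_swap z (b : bool) s : all (fun l => star z l.1) s ->
  (z, b) :: s ~ s ++ [:: (z, b)].
Proof.
elim: s => [|l s IH] /= => [_|/andP[zl /IH zs]]; first by reflexivity.
rewrite -zs -[(z, b) :: l :: s]/([:: (z, b); l] ++ s) -[X in _ ~ X]/([:: l; (z, b)] ++ s).
suff -> : [:: (z, b); l] ~ [:: l; (z, b)] by reflexivity.
case/orP: zl => [/eqP lz|zl]; last exact: word_eq_comm1.
have [->|lb] := eqVneq l (z, b); first by reflexivity.
have -> : l = linv (z, b) by clear -lz lb; case: l lz lb => y e /= ->; case: e b => -[]; rewrite ?eqxx.
by rewrite (word_eq_linv (z, b) [::]) (word_eq_linvl (z, b) [::]); reflexivity.
Qed.

(** Remove from the left as many letters of the star of [z] as possible. *)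
Lemma strip z d : exists s d', [/\ d =t s ++ d', all (fun l => star z l.1) s &
  forall l, star z l.1 -> ldiv l d' = false].
Proof.
have [n] := ubnP (size d); elim: n d => // n IH d dn.
have [[l zl /ldiv_trace_eq ld]|no] := pselect (exists2 l, star z l.1 & ldiv l d).
  have [|s [d' [dE zs zd']]] := IH (rem l d).
    have /perm_size : perm_eq d (l :: rem l d).
      by rewrite perm_to_rem // (trace_eq_mem ld) mem_head.
    by move: dn; rewrite /= => + E; rewrite E.
  exists (l :: s), d'; split=> //=; last by rewrite zl.
  by rewrite ld dE; reflexivity.
exists [::], d; split=> // l zl.
by apply/negP => ld; apply: no; exists l.
Qed.

(** A letter cancelled between [d^-1] and [z d] would be [z] itself or commute
  with it; in both cases it would be a left divisor of [d] in the star of [z]. *)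
Lemma reduced_conj z d : reduced d -> (forall l, star z l.1 -> ldiv l d = false) ->
  reduced (inv_word d ++ (z, false) :: d).
Proof.
move=> rd zd.
have rzd : reduced ((z, false) :: d) by apply: reduced_cons => //; apply: zd; rewrite /star /= eqxx.
have [a [c [k1 [dE zE r]]]] := reduced_mul (reduced_inv rd) rzd.
suff c0 : c = [::].
  apply: reduced_trace_eq r; rewrite c0 cats0 in dE; rewrite c0 in zE.
  by rewrite dE zE; reflexivity.
case: c dE zE {r} => // l c dE zE; exfalso.
have : ldiv l ((z, false) :: d) by apply: trace_eq_ldiv zE.
have dl : ldiv (linv (linv l)) d.
  move: dE => /inv_word_trace_eq; rewrite inv_wordK inv_word_cat inv_wordK /= => dE.
  by rewrite linvK; apply: trace_eq_ldiv dE.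
rewrite linvK in dl.
have zl : ~~ star z l.1 by apply/negP => /zd; rewrite dl.
move=> /= /orP[/eqP lz|/andP[lz _]]; first by rewrite -lz /star eqxx in zl.
by rewrite /star edge_sym lz orbT in zl.
Qed.

Lemma conj_word s d z (b : bool) : all (fun l => star z l.1) s ->
  inv_word (s ++ d) ++ (z, b) :: s ++ d ~ inv_word d ++ (z, b) :: d.
Proof.
move=> zs; rewrite inv_word_cat -catA -(cat_cons _ s) (star_swap b zs) -catA /=.
by rewrite (catA (inv_word s)) (word_eq_mulVg _ s); reflexivity.
Qed.

(** Once the part in the star is stripped from [d], the conjugate of [z] is
  a reduced word and has to be [z], so nothing is left of [d]. *)
Lemma centralizer z d : reduced d -> inv_word d ++ (z, false) :: d ~ [:: (z, false)] ->
  all (fun l => star z l.1) d.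
Proof.
move=> rd; have [s [d' [dE zs zd']]] := strip z d.
have rd' : reduced d' by apply: (@reduced_catr _ s); apply: reduced_trace_eq dE rd.
move=> E; have {}E : inv_word d' ++ (z, false) :: d' ~ [:: (z, false)].
  by rewrite -E (trace_eq_word_eq dE) (conj_word _ _ zs); reflexivity.
have r1 : reduced [:: (z, false)] by apply: reduced_cons => //; apply: reduced_nil.
have /trace_eq_mem E' := reduced_uniq (reduced_conj rd' zd') r1 E.
have d'0 : d' = [::].
  case: d' {rd' dE E} zd' E' => // l d' zd' E'.
  have := E' l; rewrite mem_cat in_cons mem_head !orbT inE => /esym/eqP lz.
  by have := zd' (z, false); rewrite /star /= eqxx lz eqxx => /(_ isT).
by rewrite (eq_all_r (trace_eq_mem dE)) d'0 cats0.
Qed.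

(** After stripping from [d] its part in the star of [z], the conjugate of [z] by
  the rest [d'] is a reduced word that contains [d'] and lies in the star of
  [y]. *)
Lemma commute_star_le2 y z d : reduced d ->
  let X := inv_word d ++ (z, false) :: d in
  inv_word X ++ (y, false) :: X ~ [:: (y, false)] -> star_le 2 d.
Proof.
move=> rd X; have [s [d' [dE zs zd']]] := strip z d.
have rd' : reduced d' by apply: (@reduced_catr _ s); apply: reduced_trace_eq dE rd.
set X' := inv_word d' ++ (z, false) :: d'.
have XX' : X ~ X'.
  by rewrite /X (trace_eq_word_eq dE) (conj_word _ _ zs); reflexivity.
move=> E; have {}E : inv_word X' ++ (y, false) :: X' ~ [:: (y, false)].
  by rewrite -XX' E; reflexivity.
have := centralizer (reduced_conj rd' zd') E; rewrite all_cat => /and3P[_ _ yd'].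
apply: star_le_trace_eq (trace_eq_sym dE) _; apply: (@star_le_cat _ 1 1); apply: star_le1; right.
  by exists z.
by exists y.
Qed.

End Quad.

(** * Star length in the group *)

Section Group.
Variable Gamma : sgraph.
Implicit Types (x y z : Gamma) (l m : Gamma * bool) (u v w : word Gamma) (g h k : raag Gamma).
Local Notation rels := (@raag_relators Gamma).
Local Notation "w ~ w'" := (word_eq rels w w') (at level 70).

Definition word_val w : raag Gamma := \pi_(presented rels) w.

Lemma word_val_eq u v : word_val u = word_val v <-> u ~ v.
Proof. by apply: iff_sym; apply: pi_presented. Qed.

Lemma word_valM u v : (word_val u * word_val v)%g = word_val (u ++ v).
Proof. exact: pres_mulE. Qed.

Lemma word_valV u : ((word_val u)^-1)%g = word_val (inv_word u).
Proof. exact: pres_invE. Qed.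

Lemma word_val_nil : word_val [::] = 1%g.
Proof. by []. Qed.

Lemma word_val_gen x : raag_gen x = word_val [:: (x, false)].
Proof. by []. Qed.

Lemma word_valJ u v : (word_val u ^ word_val v)%g = word_val (inv_word v ++ u ++ v).
Proof. by rewrite /conjg word_valV (word_valM u v) (word_valM (inv_word v)). Qed.

Definition reduced_word g : word Gamma := normal_form (repr (g : presented rels)).

Lemma reduced_wordK g : word_val (reduced_word g) = g.
Proof.
transitivity (word_val (repr (g : presented rels))); last exact: reprK.
by apply/word_val_eq/normal_form_word_eq.
Qed.

Lemma reduced_word_val w : reduced_word (word_val w) =t normal_form w.
Proof. by apply: word_eq_normal_form; apply: repr_pi. Qed.

Lemma reduced_wordP g : reduced (reduced_word g).
Proof. exact: normal_form_reduced. Qed.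

Definition gstar_le n g := star_le n (reduced_word g).

Lemma gstar_le_val n w : star_le n w -> gstar_le n (word_val w).
Proof. by move=> /star_le_normal_form; apply: star_le_trace_eq; symmetry; apply: reduced_word_val. Qed.

Lemma gstar_leM i j g h : gstar_le i g -> gstar_le j h -> gstar_le (i + j) (g * h)%g.
Proof.
move=> sg sh; rewrite -(reduced_wordK g) -(reduced_wordK h) word_valM.
exact/gstar_le_val/star_le_cat.
Qed.

Lemma gstar_leV n g : gstar_le n g -> gstar_le n g^-1%g.
Proof. by move=> sg; rewrite -(reduced_wordK g) word_valV; apply/gstar_le_val/star_le_inv. Qed.

(** Acylindricity in terms of star length: the elements [g] inject into the
  short prefixes of [k] that can be followed by the window [W]. *)
Lemma acyl_words n k (S : seq (raag Gamma)) :
    ~ gstar_le (2 * n + 6) k -> uniq S ->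
    {in S, forall g, gstar_le n g /\ gstar_le n (g ^ k)%g} ->
  size S <= ((2 * n + 2) * #|Gamma|).+1.
Proof.
move=> nk uS sS.
have [u0 [W [u1 [kE su0 nu0 nW nu1]]]] := star_le_window nk.
have /choice[E EP] : forall g, exists e, g \in S ->
    [/\ (g * word_val e)%g = word_val u0, star_le (2 * n + 2) e
      & tprefix (e ++ W) (reduced_word k)].
  move=> g.
  have [gS|] := boolP (g \in S); last by exists [::].
  have [sg sgk] := sS g gS.
  have [|e [ge se pe]] := quadrilateral kE su0 nu0 nu1 nk
    (@reduced_wordP k) (@reduced_wordP g) (@reduced_wordP (g ^ k)%g) sg sgk.
    by apply/word_val_eq; rewrite -!word_valM !reduced_wordK -conjgC.
  exists e => _; split=> //.
  by rewrite -[g in LHS]reduced_wordK word_valM; apply/word_val_eq.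
apply: (window_card nW uS (E := E) (k := reduced_word k)) => [g h gS hS gh|g gS|g gS].
- have [gE _ _] := EP g gS; have [hE _ _] := EP h hS.
  apply: (mulIg (word_val (E g))); rewrite gE -hE.
  by congr (_ * _)%g; apply/word_val_eq/trace_eq_word_eq/trace_eq_sym.
- by have [] := EP g gS.
- by have [] := EP g gS.
Qed.

(** Adjacent vertices of the extension graph are conjugated by elements that
  differ by a short one. *)
Lemma commute_gstar_le2 x y g h :
  commute (raag_gen x ^ g)%g (raag_gen y ^ h)%g -> gstar_le 2 (h * g^-1)%g.
Proof.
move=> c; set d := (h * g^-1)%g.
have {c} : (raag_gen x ^ (raag_gen y ^ d))%g = raag_gen x.
  have -> : (raag_gen y ^ d)%g = ((raag_gen y ^ h) ^ g^-1)%g by rewrite conjgM.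
  apply: (@conjg_inj _ g); rewrite conjJg conjgKV.
  by rewrite {1}/conjg c mulKg.
rewrite -{1}(reduced_wordK d) !word_val_gen !word_valJ => /word_val_eq.
exact: commute_star_le2 (@reduced_wordP d).
Qed.

End Group.

(** * Walks in the extension graph *)

Section Walks.
Variables (V : eqType) (adj : V -> V -> Prop).
Implicit Types (u v w : V).

Fixpoint walk n u v : Prop :=
  if n is n'.+1 then u = v \/ exists2 w, adj u w & walk n' w v else u = v.

Lemma walk_refl n u : walk n u u.
Proof. by case: n => //= n; left. Qed.

Lemma walk_mono i j u v : i <= j -> walk i u v -> walk j u v.
Proof.
elim: i j u => [|i IH] [|j] u //= => [_ ->|ij [->|[w uw wv]]]; [by left|by left|].
by right; exists w => //; apply: IH wv.
Qed.

Lemma walk_cat i j u v w : walk i u v -> walk j v w -> walk (i + j) u w.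
Proof.
move=> + vw; elim: i u => [|i IH] u; first by move=> /= ->.
move=> [->|[u' uu' /IH]]; last by right; exists u'.
by apply: walk_mono vw; rewrite leq_addl.
Qed.

(** The distance truncated at [n], which is a natural number whether or not the
  two vertices are connected. *)
Definition trunc_dist n u v : nat :=
  ex_minn (ex_intro (fun i => `[< walk i u v >] || (i == n)) n
    (introT orP (or_intror (eqxx n)))).

Lemma trunc_dist_refl n u : trunc_dist n u u = 0.
Proof.
rewrite /trunc_dist; case: ex_minnP => i _ /(_ 0).
rewrite leqn0 => H; apply/eqP/H; rewrite (_ : `[< _ >] = true) //.
exact/asboolP.
Qed.

Lemma walk_of_trunc_dist n u v : trunc_dist n u v < n -> walk n u v.
Proof.
rewrite /trunc_dist; case: ex_minnP => i /orP[/asboolP uv _ /ltnW le|/eqP ->].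
  exact: walk_mono uv.
by rewrite ltnn.
Qed.

Lemma trunc_dist_adj n o u v : adj u v -> trunc_dist n o v <= (trunc_dist n o u).+1.
Proof.
move=> uv; rewrite {1}/trunc_dist; case: ex_minnP => i _ imin.
rewrite /trunc_dist; case: ex_minnP => j /orP[/asboolP ou|/eqP ->] _; last first.
  by apply: leqW; apply: imin; rewrite eqxx orbT.
apply: imin; apply/orP; left; apply/asboolP; rewrite -addn1; apply: walk_cat ou _.
by right; exists v.
Qed.

End Walks.

Section Extension.
Variable Gamma : sgraph.
Implicit Types (x y z : Gamma) (g h k : raag Gamma) (w : word Gamma).
Local Notation adj := (@ext_adj Gamma).

Lemma ext_adj_sym u v : adj u v -> adj v u.
Proof. by move=> [uv c]; split=> [/esym//|]; exact: commute_sym. Qed.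

Lemma ext_vert_subproof x g : (raag_gen x ^ g)%g \in @ext_vertices Gamma.
Proof. by apply/mem_set; exists x, g. Qed.

Definition ext_vert x g : ext_vertex Gamma := Sub (raag_gen x ^ g)%g (ext_vert_subproof x g).

Lemma ext_vertP (u : ext_vertex Gamma) : exists x g, u = ext_vert x g.
Proof.
have /set_mem[x [g ug]] := valP u; exists x, g.
exact: val_inj.
Qed.

Lemma ext_conj_vert x g h : ext_conj (ext_vert x g) h = ext_vert x (g * h)%g.
Proof. by apply: val_inj; rewrite /= conjgM. Qed.

Lemma walk_gstar_le n x y g h : walk adj n (ext_vert x g) (ext_vert y h) ->
  gstar_le (2 * n + 2) (h * g^-1)%g.
Proof.
elim: n x g => [|n IH] x g.
  by move=> /= [e]; apply: (@commute_gstar_le2 _ x y); rewrite e; exact: commute_refl.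
move=> /= [[e]|[v [_ c] vE]].
  have := @commute_gstar_le2 _ x y g h; rewrite e => /(_ (commute_refl _)).
  by apply: star_le_mono; lia.
have [z [f vf]] := ext_vertP v; rewrite vf in c vE.
have -> : (h * g^-1)%g = (h * f^-1 * (f * g^-1))%g by rewrite mulgA mulgVK.
have -> : 2 * n.+1 + 2 = (2 * n + 2) + 2 by lia.
exact: (gstar_leM (IH _ _ vE) (commute_gstar_le2 c)).
Qed.

Lemma raag_gen_inj : injective (@raag_gen Gamma).
Proof.
move=> x y /word_val_eq xy.
have red1 z : reduced [:: (z, false)] by apply: reduced_cons => //; exact: reduced_nil.
have /trace_eq_mem/(_ (x, false)) := reduced_uniq (red1 x) (red1 y) xy.
by rewrite mem_head inE => /esym/eqP[].
Qed.

Lemma ext_vert_star z s g : all (fun l => star z l.1) s ->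
  ext_vert z (word_val s * g)%g = ext_vert z g.
Proof.
move=> zs; apply: val_inj; rewrite /= conjgM; congr (_ ^ _)%g.
have -> : raag_gen z = word_val [:: (z, false)] by [].
rewrite word_valJ; apply/word_val_eq; have := conj_word [::] false zs.
by rewrite cats0.
Qed.

Hypothesis Gamma_connected : connected_graph Gamma.

(** A simple path of [Gamma], copied into its conjugate by [g]. *)
Lemma walk_sheet x y g : walk adj #|Gamma| (ext_vert x g) (ext_vert y g).
Proof.
case/connectP: (Gamma_connected x y) => p0 /shortenP[p pp up _] ->.
have : size p <= #|Gamma| by have := max_card (mem (x :: p)); rewrite (card_uniqP up) => /ltnW.
move=> /walk_mono; apply.
elim: p x pp {up} => //= z p IH x /andP[xz /IH pr]; right; exists (ext_vert z g) => //.
split=> [/(congr1 val)/= /conjg_inj/raag_gen_inj E|].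
  by rewrite E edge_irrefl in xz.
rewrite /commute /= -!conjMg; congr (_ ^ _)%g.
have -> : (raag_gen x * raag_gen z)%g = word_val [:: (x, false); (z, false)] by apply: word_valM.
have -> : (raag_gen z * raag_gen x)%g = word_val [:: (z, false); (x, false)] by apply: word_valM.
by apply/word_val_eq; apply: word_eq_comm1.
Qed.

(** The copies of [Gamma] conjugated by [v g] and by [s v g] share the vertex [z]
  when [s] is a word in the star of [z]; walk to it in one and back in the
  other. *)
Lemma gstar_le_walk n x h g : gstar_le n h ->
  walk adj (n * (2 * #|Gamma|)) (ext_vert x g) (ext_vert x (h * g)%g).
Proof.
rewrite /gstar_le -{2}(reduced_wordK h); move: (reduced_word h) => w {h}.
elim: n w => [w /= ->|n IH w /= [s [v [ss /IH sv /trace_eq_word_eq/word_val_eq wE]]]].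
  by rewrite word_val_nil mul1g.
have -> : (word_val w * g)%g = (word_val s * (word_val v * g))%g.
  by rewrite wE -(word_valM s v) mulgA.
rewrite mulSn addnC; apply: walk_cat sv _.
case: ss => [->|[z zs]]; first by rewrite word_val_nil mul1g; exact: walk_refl.
rewrite mul2n -addnn; apply: walk_cat (walk_sheet x z _) _.
by rewrite -(ext_vert_star (word_val v * g)%g zs); exact: walk_sheet.
Qed.

End Extension.

(** * The geometric realization *)

Local Open Scope classical_set_scope.
Local Open Scope ring_scope.

Section Realized.
Variables (R : realType) (V : eqType) (adj : V -> V -> Prop).
Implicit Types (u v w : V) (s t l : R) (F : V -> R).
Local Notation X := (realization R adj).
Local Notation path_dist := (@path_dist R V adj).

(** The value at an edge point of the function that is affine on edges and equal
  to [F] on vertices. *)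
Definition affine_value F u v t : R := (1 - t) * F u + t * F v.

Lemma sum_edge_point (e : seq V) F u v t : uniq e -> u \in e -> v \in e ->
  \sum_(w <- e) edge_point u v t w * F w = affine_value F u v t.
Proof.
move=> ue uin vin.
have one z c : z \in e -> \sum_(w <- e) c * (w == z)%:R * F w = c * F z.
  move=> zin; rewrite (bigD1_seq z) //= eqxx mulr1 big1 ?addr0 // => w /negbTE ->.
  by rewrite mulr0 mul0r.
rewrite /affine_value -(one u) // -(one v) // -big_split /=.
by apply: eq_bigr => w _; rewrite -mulrDl.
Qed.

(** The value depends on the point only: it is the pairing of [F] with the
  barycentric coordinates. *)
Lemma affine_value_edge_point F u v s u' v' t :
  edge_point u v s = edge_point u' v' t -> affine_value F u v s = affine_value F u' v' t.
Proof.
move=> E; have ue := undup_uniq [:: u; v; u'; v'].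
rewrite -(sum_edge_point F s ue) ?mem_undup ?inE ?eqxx ?orbT // E.
by rewrite (sum_edge_point F t ue) ?mem_undup ?inE ?eqxx ?orbT.
Qed.

(** A function that is 1-Lipschitz on vertices stays so along strings once
  extended affinely; this bounds lengths of strings from below. *)
Lemma edge_string_lip F (p q : X) l :
    (forall u v, adj u v -> `|F u - F v| <= 1) -> edge_string p q l ->
  forall u v s u' v' t, bary p = edge_point u v s -> bary q = edge_point u' v' t ->
  `|affine_value F u v s - affine_value F u' v' t| <= l.
Proof.
move=> lip; elim=> [{}p|{}p {}q z a b s t {}l ab s01 t01 pE qE _ IH] u v c u' v' d.
  by move=> pE; rewrite pE => /affine_value_edge_point ->; rewrite subrr normr0.
rewrite pE => /(affine_value_edge_point F) <- zE.
apply: le_trans (ler_distD (affine_value F a b t) _ _) _; apply: lerD; last exact: IH zE.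
have -> : affine_value F a b s - affine_value F a b t = (t - s) * (F a - F b).
  by rewrite /affine_value; ring.
by rewrite normrM distrC ler_piMr // lip.
Qed.

Fact vertex_point_subproof u : is_bary adj (edge_point u u (0 : R)).
Proof. by exists u, u, 0; split=> //; [left|rewrite lexx ler01]. Qed.

Definition vertex_point u : X := Realization (vertex_point_subproof u).

Lemma edge_point_left u v : edge_point u v (0 : R) = edge_point u u 0.
Proof. by apply/funext => w; rewrite /edge_point !mul0r. Qed.

Lemma edge_point_right u v : edge_point u v (1 : R) = edge_point v v 0.
Proof. by apply/funext => w; rewrite /edge_point subrr !mul0r subr0 add0r addr0. Qed.

Lemma edge_point_diag u t : edge_point u u t = edge_point u u 0.
Proof. by apply/funext => w; rewrite /edge_point; ring. Qed.

Lemma walk_edge_string n u v (q : X) l : walk adj n u v ->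
  edge_string (vertex_point v) q l ->
  exists2 l', edge_string (vertex_point u) q l' & l' <= n%:R + l.
Proof.
move=> + vq; elim: n u => [|n IH] u /=; first by move=> ->; exists l; rewrite ?add0r.
move=> [->|[w uw /IH[l' wq le]]]; first by exists l; rewrite // lerDr.
exists (`|0 - 1| + l'); last by rewrite sub0r normrN1 -natr1; lra.
apply: (edge_string_cons uw _ _ _ _ wq); rewrite ?lexx ?ler01 //=.
  by rewrite (edge_point_left u w).
by rewrite (edge_point_right u w).
Qed.

(** Go from [p] to [u], along the walk to [u'], then to [q]. *)
Lemma path_dist_walk n (p q : X) u v s u' v' t :
    u = v \/ adj u v -> 0 <= s <= 1 -> bary p = edge_point u v s ->
    u' = v' \/ adj u' v' -> 0 <= t <= 1 -> bary q = edge_point u' v' t ->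
  walk adj n u u' -> (path_dist p q <= (n%:R + 2)%:E)%E.
Proof.
move=> uv s01 pE uv' t01 qE uu'.
have [l uq le] : exists2 l, edge_string (vertex_point u') q l & l <= 1.
  case: uv' => [e|uv'].
    have -> : q = vertex_point u' by apply: bary_inj; rewrite qE -e edge_point_diag.
    by exists 0; [exact: edge_string_nil|exact: ler01].
  exists (`|0 - t| + 0); last by rewrite addr0 sub0r normrN ger0_norm; lra.
  apply: (edge_string_cons uv' _ t01 _ qE (edge_string_nil _)); rewrite ?lexx ?ler01 //=.
  by rewrite edge_point_left.
have [l' ul' le'] := walk_edge_string uu' uq.
apply: ge_ereal_inf.
case: uv => [e|uv].
  have -> : p = vertex_point u by apply: bary_inj; rewrite pE -e edge_point_diag.
  by exists l'%:E; [exists l'|rewrite lee_fin; lra].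
exists (`|s - 0| + l')%:E; last by rewrite lee_fin subr0 ger0_norm; lra.
exists (`|s - 0| + l') => //.
apply: (edge_string_cons uv s01 _ pE _ ul'); rewrite ?lexx ?ler01 //=.
by rewrite edge_point_left.
Qed.

(** Apply [edge_string_lip] to the truncated distance from [u]: its values are at
  most 1 at [p], so less than [r + 2] at [q], and less than [r + 3] at [u']. *)
Lemma walk_path_dist (n : nat) r (p q : X) u v u' v' t :
    (forall u v, adj u v -> adj v u) ->
    u = v \/ adj u v -> u' = v' \/ adj u' v' -> 0 <= t <= 1 ->
    bary p = edge_point u v t -> bary q = edge_point u' v' t ->
    r + 3 < n%:R -> (path_dist p q <= r%:E)%E ->
  walk adj n u u'.
Proof.
move=> adjC uv uv' t01 pE qE rn dpq.
have [_ [l pq <-]] : exists2 y, [set l%:E | l in edge_string p q]%classic y & (y < (r + 1)%:E)%E.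
  by apply: ereal_inf_lt; apply: le_lt_trans dpq _; rewrite lte_fin ltrDl ltr01.
rewrite lte_fin => lr.
pose F w : R := (trunc_dist adj n u w)%:R.
have F1 a b : adj a b -> F b <= F a + 1.
  by move=> ab; rewrite /F natr1 ler_nat; apply: trunc_dist_adj.
have lip a b : adj a b -> `|F a - F b| <= 1.
  by move=> ab; rewrite ler_distl; have := F1 _ _ ab; have := F1 _ _ (adjC _ _ ab); lra.
have lip' a b : a = b \/ adj a b -> F b <= F a + 1 /\ F a <= F b + 1.
  move=> [->|ab]; first by split; rewrite lerDl ler01.
  by split; apply: F1 => //; apply: adjC.
have := edge_string_lip lip pq pE qE.
rewrite ler_distl => /andP[+ _]; rewrite /affine_value.
have Fu : F u = 0 by rewrite /F trunc_dist_refl.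
have [Fv _] := lip' _ _ uv; have [_ Fu'] := lip' _ _ uv'.
rewrite Fu in Fv *; move=> H.
have Fu'n : F u' < n%:R.
  case/andP: t01 => t0 t1.
  have : t * F v <= t * (0 + 1) by rewrite ler_wpM2l.
  have : t * F u' <= t * (F v' + 1) by rewrite ler_wpM2l.
  lra.
by apply: walk_of_trunc_dist; rewrite -(ltr_nat R).
Qed.

End Realized.

Lemma card_le_seq (T : choiceType) (A : set T) (N : nat) :
    (forall s : seq T, uniq s -> {in s, forall x, A x} -> (size s <= N)%N) ->
  (A #<= `I_N)%card.
Proof.
move=> sN; have fN (X : {fset T}) : [set` X]%classic `<=` A -> (#|` X| <= N)%N.
  by move=> XA; apply: sN; [exact: fset_uniq|exact: XA].
have [/finite_fsetP[X AX]|infA] := pselect (finite_set A); last first.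
  by have [X /fN] := infinite_set_fset N.+1 infA; rewrite leqNgt => /negP.
have /card_eq_fsetP XN : #|` X| = #|` X| by [].
by rewrite AX (card_le_eql XN) card_le_II fN // AX.
Qed.

Theorem theorem30 (R : realType) (Gamma : sgraph)
    (Gamma_connected : connected_graph Gamma) :
  acylindrical (conjugation_action R Gamma).
Proof.
move=> r r0; pose n0 := (Num.truncn r).+4; pose n := (2 * n0 + 2)%N.
pose K := (2 * n + 6)%N; pose B := (K * (2 * #|Gamma|) + #|Gamma|)%N.
(* [k] of star length at most [K] would give a walk of length [B] between the
   vertices near [p] and [q], hence a distance at most [B + 2] *)
exists (B%:R + 3), ((2 * n + 2) * #|Gamma|).+1; split=> // p q pq.
have rn0 : r + 3 < n0%:R.
  have := truncnS_gt r; rewrite /n0 -!natr1; lra.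
have [u [v [s [uv s01 pE]]]] := baryP p.
have [u' [v' [t [uv' t01 qE]]]] := baryP q.
have [x [h1 uE]] := ext_vertP u; have [y [h2 uE']] := ext_vertP u'.
pose k := (h1 * h2^-1)%g.
have nk : ~ gstar_le K k.
  move=> kK; have : walk (@ext_adj Gamma) B u u'.
    rewrite uE uE'; apply: walk_cat (walk_sheet Gamma_connected x y h2).
    have := gstar_le_walk Gamma_connected x h1 (gstar_leV kK).
    by rewrite invgM invgK mulgVK.
  move=> /(path_dist_walk uv s01 pE uv' t01 qE) /(le_trans pq).
  by rewrite lee_fin; lra.
(* [g] moves the vertex [b] near [a] by at most [n0] edges *)
have moved (a : ext_space R Gamma) b c d z h g : bary a = edge_point b c d ->
    b = c \/ ext_adj b c -> 0 <= d <= 1 -> b = ext_vert z h ->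
    (path_dist a (ext_act a g) <= r%:E)%E -> gstar_le n (h * g * h^-1)%g.
  move=> aE bc d01 bE ag.
  apply: (@walk_gstar_le _ n0 z z); rewrite -ext_conj_vert -bE.
  apply: (walk_path_dist (v' := ext_conj c g) (@ext_adj_sym Gamma) bc _ d01 aE _ rn0 ag).
    by case: bc => [->|bc]; [left|right; apply: ext_conj_adj].
  by rewrite /= aE edge_point_conj.
apply: card_le_seq => S uS SP.
rewrite -(size_map (fun g => g ^ h1^-1)%g); apply: (acyl_words (k := k)) => //.
  by rewrite map_inj_uniq //; apply: conjg_inj.
move=> _ /mapP[g /SP[/= gp gq] ->]; split.
  have := moved _ _ _ _ _ _ _ pE uv s01 uE gp.
  by rewrite /conjg invgK mulgA.
have := moved _ _ _ _ _ _ _ qE uv' t01 uE' gq.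
by rewrite -conjgM /k mulKg /conjg invgK mulgA.
Qed.
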